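(* Let $t \ge 3$ and $n \ge 3$ be integers and let $W_n = C_n + K_1$ be the wheel. Then $M_t(W_n)$ is not a distance magic graph.
   Context: $C_n + K_1$ denotes the join of the cycle $C_n$ with a single vertex (the wheel with $n$ rim vertices). For a graph $G=(V,E)$ and an integer $t \ge 1$, the generalised Mycielskian $M_t(G)$ is the graph with vertex set $(V \times \{0,1,\dots,t-1\}) \cup \{u\}$ (where $u$ is a new vertex), whose edges are: $(x,0)(y,0)$ for every edge $xy \in E$; $(x,i)(y,i+1)$ for every $0 \le i \le t-2$ and every ordered pair $(x,y)$ with $xy \in E$; and $(x,t-1)u$ for every $x \in V$. A graph $H$ on $N$ vertices is distance magic if there is a bijection $f: V(H) \to \{1,2,\dots,N\}$ and a constant $k$ such that for every vertex $v$, $\sum_{w \in N(v)} f(w) = k$, where $N(v)$ is the open neighbourhood of $v$. *)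

(* Defs.v *)
From mathcomp Require Import all_boot.

Set Implicit Arguments.
Unset Strict Implicit.
Unset Printing Implicit Defensive.

Record sgraph := SGraph {
  vertex :> finType;
  adj : rel vertex;
  adj_sym : symmetric adj;
  adj_irrefl : irreflexive adj
}.

Section Cycle.
Variable n : nat.

(* The guard [i != j] only matters for n = 1, where it excludes a loop. *)
Definition cycle_adj (i j : 'I_n) : bool :=
  (i != j) && ((nat_of_ord j == i.+1 %% n) || (nat_of_ord i == j.+1 %% n)).

Lemma cycle_adj_sym : symmetric cycle_adj.
Proof. by move=> i j; rewrite /cycle_adj eq_sym orbC. Qed.

Lemma cycle_adj_irrefl : irreflexive cycle_adj.
Proof. by move=> i; rewrite /cycle_adj eqxx. Qed.

Definition cycle_graph : sgraph := SGraph cycle_adj_sym cycle_adj_irrefl.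

End Cycle.

Section Complete.
Variable n : nat.

Definition complete_adj (i j : 'I_n) : bool := i != j.

Lemma complete_adj_sym : symmetric complete_adj.
Proof. by move=> i j; rewrite /complete_adj eq_sym. Qed.

Lemma complete_adj_irrefl : irreflexive complete_adj.
Proof. by move=> i; rewrite /complete_adj eqxx. Qed.

Definition complete_graph : sgraph :=
  SGraph complete_adj_sym complete_adj_irrefl.

End Complete.

Section Join.
Variables G H : sgraph.

Definition join_adj (a b : (G + H)%type) : bool :=
  match a, b with
  | inl x, inl y => adj x y
  | inr x, inr y => adj x y
  | _, _ => true
  end.

Lemma join_adj_sym : symmetric join_adj.
Proof. by move=> [x|x] [y|y] //=; rewrite adj_sym. Qed.

Lemma join_adj_irrefl : irreflexive join_adj.
Proof. by move=> [x|x] /=; rewrite adj_irrefl. Qed.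

Definition join_graph : sgraph := SGraph join_adj_sym join_adj_irrefl.

End Join.

Definition wheel (n : nat) : sgraph :=
  join_graph (cycle_graph n) (complete_graph 1).

Section Mycielskian.
Variables (t : nat) (G : sgraph).

(* [Some (x, i)] is the vertex (x, i) of V x {0, ..., t-1} and [None] is the
   new vertex u. *)
Definition mycielskian_adj (a b : option (G * 'I_t)) : bool :=
  match a, b with
  | Some (x, i), Some (y, j) =>
      adj x y &&
      [|| (nat_of_ord i == 0) && (nat_of_ord j == 0),
          nat_of_ord j == i.+1 | nat_of_ord i == j.+1]
  | Some (_, i), None => i.+1 == t
  | None, Some (_, j) => j.+1 == t
  | None, None => false
  end.

Lemma mycielskian_adj_sym : symmetric mycielskian_adj.
Proof.
move=> [[x i]|] [[y j]|] //=.
by rewrite adj_sym (andbC (nat_of_ord i == 0)) (orbC (nat_of_ord j == i.+1)).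
Qed.

Lemma mycielskian_adj_irrefl : irreflexive mycielskian_adj.
Proof. by move=> [[x i]|] //=; rewrite adj_irrefl. Qed.

Definition mycielskian : sgraph :=
  SGraph mycielskian_adj_sym mycielskian_adj_irrefl.

End Mycielskian.

Definition distance_magic (H : sgraph) : Prop :=
  exists (f : H -> nat) (k : nat),
    [/\ injective f,
        forall m : nat, (exists v : H, f v = m) <-> 1 <= m <= #|H|
      & forall v : H, \sum_(w : H | adj v w) f w = k].

(* Main.v *)
Require Import Defs.
From mathcomp Require Import all_boot.

(** Let [k] be the magic constant, [S_i] the sum of the rim labels and [c_i] the
    hub label on level [i].  The hub copies on levels 0 and 1 give
    [S_0 + S_1 = k = S_0 + S_2].  Summing the conditions at all rim copies of
    level 0, resp. 1, gives [2 (S_0 + S_1) + n (c_0 + c_1) = n k], resp.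
    [2 (S_0 + S_2) + n (c_0 + c_2) = n k], because the rim is 2-regular.  Hence
    [c_1 = c_2], which contradicts the injectivity of the labelling. *)

Set Implicit Arguments.
Unset Strict Implicit.
Unset Printing Implicit Defensive.

Definition regular (G : sgraph) (d : nat) : Prop :=
  forall x : G, #|[pred y | adj x y]| = d.

(** Double counting: each [g y] occurs once for each of the [d] neighbours of [y]. *)
Lemma sum_adj_regular (G : sgraph) (d : nat) (g : G -> nat) :
  regular G d -> \sum_(x : G) \sum_(y | adj x y) g y = d * \sum_(y : G) g y.
Proof.
move=> regG; rewrite (exchange_big_dep xpredT) //= big_distrr /=.
apply: eq_bigr => y _; rewrite sum_nat_const -(regG y); congr (_ * _).
by apply: eq_card => x; rewrite !inE adj_sym.
Qed.

Lemma cycle_graph_regular (n : nat) : 3 <= n -> regular (cycle_graph n) 2.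
Proof.
move=> n_ge3 i.
have ordS_pred (j : 'I_n) : (val i == j.+1 %% n) = (j == ord_pred i).
  by rewrite -(can2_eq (@ordSK n) (@ord_predK n)) [RHS]eq_sym -val_eqE.
(* Used with [m = 1] to separate [i] from its two neighbours, and with [m = 2], where [3 <= n]
   matters, to separate these from each other. *)
have shift_neq m : 0 < m < n -> (i + m) %% n != i.
  move=> /andP[m_gt0 m_ltn]; rewrite -[X in _ != X](modn_small (ltn_ord i)).
  by rewrite -[X in _ != X %% n]addn0 eqn_modDl mod0n modn_small // -lt0n.
have neqS : i != ordS i.
  by rewrite eq_sym -val_eqE /= -addn1 shift_neq // (ltn_trans _ n_ge3).
have neqP : i != ord_pred i.
  by rewrite eq_sym (can2_eq (@ord_predK n) (@ordSK n)) neqS.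
have neqSP : ordS i != ord_pred i.
  rewrite -(can2_eq (@ordSK n) (@ord_predK n)) -val_eqE /=.
  by rewrite -addn1 modnDml addn1 -addn2 shift_neq.
rewrite (eq_card (B := pred2 (ordS i) (ord_pred i))) ?card2 ?neqSP // => j.
rewrite !inE /= /cycle_adj ordS_pred -[_ == i.+1 %% n]/(j == ordS i).
by case: eqP => [<-|_] //=; rewrite (negPf neqS) (negPf neqP).
Qed.

Lemma sum_adj_join_l (G H : sgraph) (g : join_graph G H -> nat) (x : G) :
  \sum_(y : join_graph G H | adj (inl x : join_graph G H) y) g y =
  \sum_(y | adj x y) g (inl y) + \sum_y g (inr y).
Proof. by rewrite big_sumType. Qed.

Lemma sum_adj_join_r (G H : sgraph) (g : join_graph G H -> nat) (x : H) :
  \sum_(y : join_graph G H | adj (inr x : join_graph G H) y) g y =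
  \sum_y g (inl y) + \sum_(y | adj x y) g (inr y).
Proof. by rewrite big_sumType. Qed.

(** Below the top level, [None] is not a neighbour, so its term drops out. *)
Lemma sum_adj_mycielskian (t : nat) (G : sgraph)
    (f : mycielskian t G -> nat) (x : G) (i : 'I_t) :
  i.+1 != t ->
  \sum_(w : mycielskian t G | adj (Some (x, i) : mycielskian t G) w) f w =
  \sum_(y | adj x y)
    \sum_(j : 'I_t | [|| (val i == 0) && (val j == 0),
                         val j == i.+1 | val i == j.+1]) f (Some (y, j)).
Proof.
move=> i_lt; rewrite pair_big_dep /=.
rewrite (reindex_omap (Some : G * 'I_t -> mycielskian t G) id).
  by apply: eq_big => -[y j] /=; rewrite ?eqxx ?andbT.
by case=> //=; rewrite (negPf i_lt).
Qed.

(** The argument sees the rim only as a nonempty regular graph, hence this generality. *)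
Lemma mycielskian_regular_cone_not_distance_magic (t d : nat) (G : sgraph) :
  3 <= t -> 0 < #|G| -> regular G d ->
  ~ distance_magic (mycielskian t (join_graph G (complete_graph 1))).
Proof.
case: t => [|[|[|t]]] // _ G_gt0 regG [f [k [f_inj _ magic]]].
set W := join_graph G (complete_graph 1) in f f_inj magic.
pose o0 : 'I_t.+3 := ord0.
pose o1 : 'I_t.+3 := Ordinal (isT : 1 < t.+3).
pose o2 : 'I_t.+3 := Ordinal (isT : 2 < t.+3).
(* Adding the labels of two levels turns the magic condition into one about a single weighting of
   [W]. *)
have level0 (x : W) :
    \sum_(y | adj x y) (f (Some (y, o0)) + f (Some (y, o1))) = k.
  rewrite -(magic (Some (x, o0))) sum_adj_mycielskian //.
  apply: eq_bigr => y _; rewrite (bigD1 o0) //= (bigD1 o1) //=.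
  by rewrite big1 ?addn0 // => -[[|[|j]] j_lt].
have level1 (x : W) :
    \sum_(y | adj x y) (f (Some (y, o0)) + f (Some (y, o2))) = k.
  rewrite -(magic (Some (x, o1))) sum_adj_mycielskian //.
  apply: eq_bigr => y _; rewrite (bigD1 o0) //= (bigD1 o2) //=.
  by rewrite big1 ?addn0 // => -[[|[|[|j]]] j_lt].
pose hub : W := inr ord0.
(* The condition at the hub makes the rim total of [g] equal to [k]; summing the conditions over the
   rim then determines [g hub]. *)
have hub_sum (g : W -> nat) : (forall x, \sum_(y | adj x y) g y = k) ->
    d * k + #|G| * g hub = #|G| * k.
  move=> gk; have := gk hub.
  rewrite sum_adj_join_r [X in _ + X]big1 ?addn0 => [rim_sum|y]; last first.
    by rewrite (ord1 y) adj_irrefl.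
  rewrite -[in LHS]rim_sum -(sum_adj_regular _ regG).
  rewrite -sum_nat_const -big_split -sum_nat_const; apply: eq_bigr => x _.
  by rewrite -(gk (inl x)) sum_adj_join_l big_ord1.
have /eqP := hub_sum _ level0; rewrite -(hub_sum _ level1) eqn_add2l.
(* Cancelling [#|G| > 0] and the common label of [(hub, o0)] leaves equal labels at [(hub, o1)] and
   [(hub, o2)]. *)
by rewrite eqn_pmul2l // eqn_add2l => /eqP /f_inj.
Qed.

Theorem theorem2p11 (t n : nat) (ht : 3 <= t) (hn : 3 <= n) :
  ~ distance_magic (mycielskian t (wheel n)).
Proof.
apply: mycielskian_regular_cone_not_distance_magic ht _ (cycle_graph_regular hn).
by rewrite card_ord (ltn_trans _ hn).
Qed.
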